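(* For every integer $k\ge 3$, there are infinitely many $(2k-2)$-connected essentially $(4k-6)$-edge-connected $(2k-2)$-regular simple graphs $G$ with $|E(G)|$ divisible by $k$ which admit no $k$-star-decomposition.
   Context: A simple graph has no loops and no multiple edges. A graph is essentially $\lambda$-edge-connected if, for every edge cut of size strictly less than $\lambda$, all edges of the cut are incident with a common vertex. A $k$-star is the star $K_{1,k}$ (one center vertex joined to $k$ leaves); a $k$-star-decomposition of $G$ is a partition of $E(G)$ into edge sets each of which forms a copy of $K_{1,k}$. *)

(* Defs.v *)
From mathcomp Require Import all_boot.

Set Implicit Arguments.
Unset Strict Implicit.
Unset Printing Implicit Defensive.

Record sgraph := SGraph {
  vertex :> finType;
  adj : rel vertex;
  adj_sym : symmetric adj;
  adj_irrefl : irreflexive adj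
}.

Definition isomorphic (G H : sgraph) : Prop :=
  exists f : G -> H,
    bijective f /\ forall x y : G, adj (f x) (f y) = adj x y.

(* An edge is the set of its two ends, so that an unordered pair is counted
   once. *)
Definition edges (G : sgraph) : {set {set G}} :=
  [set [set x; y] | x in [set: G], y in [set: G] & adj x y].

Definition regular (d : nat) (G : sgraph) : Prop :=
  forall x : G, #|[set y | adj x y]| = d.

(* Adjacency in G - S. *)
Definition adj_del (G : sgraph) (S : {set G}) : rel G :=
  [rel x y | [&& x \notin S, y \notin S & adj x y]].

(* More than k vertices, and no deletion of fewer than k vertices disconnects
   the graph; in particular K_n is (n-1)-connected but not n-connected. *)
Definition k_connected (k : nat) (G : sgraph) : Prop :=
  k < #|G| /\
  forall S : {set G}, #|S| < k ->
    forall x y : G, x \notin S -> y \notin S -> connect (adj_del S) x y.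

Definition edge_cut (G : sgraph) (X : {set G}) : {set {set G}} :=
  [set [set x; y] | x in X, y in ~: X & adj x y].

Definition essentially_edge_connected (l : nat) (G : sgraph) : Prop :=
  forall X : {set G}, X != set0 -> X != [set: G] -> #|edge_cut X| < l ->
    exists v : G, forall A : {set G}, A \in edge_cut X -> v \in A.

(* F is the edge set of a copy of K_{1,k} with centre c and leaf set L. *)
Definition is_star (k : nat) (G : sgraph) (F : {set {set G}}) : Prop :=
  exists (c : G) (L : {set G}),
    [/\ c \notin L, #|L| = k & F = [set [set c; y] | y in L]].

Definition star_decomposable (k : nat) (G : sgraph) : Prop :=
  exists P : {set {set {set G}}},
    partition P (edges G) /\
    forall F : {set {set G}}, F \in P -> is_star k F.

(* Main.v *)
(* In a k-star-decomposition every edge contains the centre of its star, so the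
   vertices that are not centres form an independent set; there are |E|/k stars
   and |E| = (k-1)n, hence this set has at least n/k vertices.  It therefore
   suffices to build highly connected (2k-2)-regular graphs with k | n whose
   independence number is below n/k.

   For k >= 4, the Cartesian product of K_(2k-3) with a long cycle has
   independence number at most n/(2k-3) < n/k.  For k = 3 this is only n/3, and
   the triangles are replaced by seven-vertex gadgets of independence number 2,
   consecutive ones being joined by three edges, which gives 2n/7 < n/3.

   In both families 2k-3 disjoint cycles ("columns") run around the ring.  An
   edge cut meets every non-constant column at least twice, so it has at least
   4k-6 edges unless some column is constant, and then the edges between columns
   make up the difference.  After the deletion of at most 2k-3 vertices, either
   a column is intact and everything else attaches to it, or each column has
   lost exactly one vertex and is still a path. *)
Require Import Defs.
From mathcomp Require Import all_boot.
From HB Require Import structures.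
From mathcomp Require Import all_algebra zify.

Set Implicit Arguments.
Unset Strict Implicit.
Unset Printing Implicit Defensive.

Import GRing.Theory.

(** * Edge cuts, degree counts and the independence obstruction *)

Lemma edge_cutC (G : sgraph) (X : {set G}) : edge_cut (~: X) = edge_cut X.
Proof.
apply/setP => A; apply/imset2P/imset2P => -[x y].
  rewrite !inE negbK => xX /andP[yX xy] ->.
  by exists y x; rewrite ?inE ?xX 1?adj_sym // setUC.
rewrite !inE => xX /andP[yX xy] ->.
by exists y x; rewrite ?inE ?negbK ?xX 1?adj_sym // setUC.
Qed.

(** Each cut edge has exactly one end in [X], so sending a pair (inner end, outer end) to its edge
    is injective. *)
Lemma card_edge_cut (G : sgraph) (X : {set G}) :
  #|edge_cut X| = \sum_(x in X) #|[set y | adj x y & y \notin X]|.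
Proof.
pose P := [set p : G * G | (p.1 \in X) && (adj p.1 p.2 && (p.2 \notin X))].
have -> : edge_cut X = (fun p => [set p.1; p.2]) @: P.
  apply/setP => A; apply/imset2P/imsetP => [[x y] | [[x y]]].
    rewrite !inE => xX /andP[yX xy] ->.
    by exists (x, y); rewrite // inE /= xX xy.
  rewrite inE /= => /and3P[xX xy yX] ->.
  by exists x y; rewrite ?inE ?yX.
rewrite card_in_imset; last first.
  move=> [x y] [x' y']; rewrite !inE /= => /and3P[xX _ yX] /and3P[x'X _ y'X] E.
  have : x \in [set x'; y'] by rewrite -E !inE eqxx.
  rewrite !inE => /orP[/eqP xx|/eqP xy]; last by rewrite -xy xX in y'X.
  have : y \in [set x'; y'] by rewrite -E !inE eqxx orbT.
  rewrite !inE => /orP[/eqP yx|/eqP -> //]; last by rewrite xx.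
  by rewrite yx x'X in yX.
rewrite -sum1_card.
under [RHS]eq_bigr => x _ do rewrite -sum1_card.
rewrite pair_big_dep /=.
by apply: eq_bigl => -[x y]; rewrite !inE.
Qed.

Lemma handshake (G : sgraph) :
  #|edges G| * 2 = \sum_(x : G) #|[set y | adj x y]|.
Proof.
have card2 A : A \in edges G -> #|A| = 2.
  case/imset2P => x y _; rewrite !inE => /andP[_ xy] ->.
  by rewrite cards2; case: eqP xy => [->|//]; rewrite adj_irrefl.
have inc (x : G) : #|[set y | adj x y]| = \sum_(A in edges G) (x \in A).
  rewrite -big_mkcondr /= sum1dep_card.
  rewrite -(@card_in_imset _ _ (fun y => [set x; y])); last first.
    move=> y z; rewrite !inE => xy _ E.
    have : y \in [set x; z] by rewrite -E !inE eqxx orbT.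
    rewrite !inE => /orP[/eqP yx|/eqP //].
    by rewrite yx adj_irrefl in xy.
  apply: eq_card => A; rewrite inE; apply/imsetP/andP.
    case=> y; rewrite inE => xy ->; split; last by rewrite !inE eqxx.
    by apply/imset2P; exists x y; rewrite ?inE.
  case=> /imset2P[y z _]; rewrite !inE => /andP[_ yz] ->.
  rewrite !inE => /orP[] /eqP->; first by exists z; rewrite ?inE.
  by exists y; rewrite ?inE 1?adj_sym // setUC.
under eq_bigr => x _ do rewrite inc.
rewrite exchange_big /= -sum_nat_const; apply: eq_bigr => A /card2 <-.
by rewrite -sum1_card big_mkcond; apply: eq_bigr => x _; case: ifP.
Qed.

(** A cut with a single vertex on one side consists of edges at that vertex, so only the remaining
    cuts have to be large. *)
Lemma essentially_edge_connected_intro (l : nat) (G : sgraph) :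
  (forall X : {set G}, 1 < #|X| -> 1 < #|~: X| -> l <= #|edge_cut X|) ->
  essentially_edge_connected l G.
Proof.
move=> cutP X X0 XT ltX.
have star v (Y : {set G}) : Y = [set v] ->
    forall A, A \in edge_cut Y -> v \in A.
  move=> -> A /imset2P[x y]; rewrite !inE => /eqP-> _ ->.
  by rewrite !inE eqxx.
have sing (Y : {set G}) : Y != set0 -> #|Y| <= 1 -> exists v, Y = [set v].
  rewrite -card_gt0 => Y0 Y1; apply/cards1P.
  by rewrite eqn_leq Y1.
have [X1|X1] := leqP #|X| 1.
  by have [v Xv] := sing X X0 X1; exists v; apply: star.
have [X2|X2] := leqP #|~: X| 1.
  have X'0 : ~: X != set0 by rewrite -setCT (inj_eq (@setC_inj _)).
  have [v Xv] := sing _ X'0 X2; exists v; rewrite -edge_cutC; exact: star.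
by have := cutP X X1 X2; rewrite leqNgt ltX.
Qed.

(** At most [#|P|] vertices are centres, and [k * #|P| = #|edges G| = #|G| * (k - 1)] by
    handshaking; the non-centres form [I]. *)
Lemma star_decomposable_independent (k : nat) (G : sgraph) :
  regular (2 * k - 2) G -> 0 < k -> star_decomposable k G ->
  exists2 I : {set G}, {in I &, forall x y, ~~ adj x y} & #|G| <= k * #|I|.
Proof.
move=> reg k0 [P [partP starP]].
pose centre (F : {set {set G}}) (c : G) :=
  [exists L : {set G},
     [&& c \notin L, #|L| == k & F == [set [set c; y] | y in L]]].
have centreP F : F \in P -> exists c, centre F c.
  move=> /starP[c [L [cL Lk FL]]]; exists c; apply/existsP; exists L.
  by rewrite cL Lk FL !eqxx.
(* [pick] fixes one centre per star, so [cs] has at most [#|P|] elements; its values are options,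
   and [None] never arises from a block of [P]. *)
pose cs := [set [pick c | centre F c] | F in P].
pose I := [set c | Some c \notin cs].
have [cov triv _] := and3P partP.
exists I.
  move=> x y; rewrite !inE => xI yI; apply/negP => xy.
  have : [set x; y] \in edges G by apply/imset2P; exists x y; rewrite ?inE.
  rewrite -(eqP cov) => /bigcupP[F FP xyF].
  have : [pick c | centre F c] \in cs by apply: imset_f.
  case: pickP => [c /existsP[L /and3P[cL _ /eqP FL]] ccs|]; last first.
    by have [c cF] := centreP _ FP; move/(_ c); rewrite cF.
  move: xyF; rewrite FL => /imsetP[z _ E].
  have : c \in [set x; y] by rewrite E !inE eqxx.
  by rewrite !inE => /orP[] /eqP ce; rewrite -ce ccs in xI yI.
have cardP : k * #|P| = #|edges G|.
  rewrite (card_partition partP) mulnC -sum_nat_const.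
  apply: eq_bigr => F /starP[c [L [cL <- ->]]].
  rewrite card_in_imset // => y z yL zL E.
  have : y \in [set c; z] by rewrite -E !inE eqxx orbT.
  by rewrite !inE => /orP[/eqP yc|/eqP //]; rewrite -yc yL in cL.
have cardE : #|edges G| * 2 = #|G| * (2 * k - 2).
  by rewrite handshake (eq_bigr _ (fun x _ => reg x)) sum_nat_const.
have cardI : #|G| <= #|I| + #|P|.
  rewrite -(cardC (mem I)) leq_add2l.
  apply: leq_trans (leq_imset_card (fun F => [pick c | centre F c]) P).
  have someI : injective (@Some G) by move=> x y [].
  rewrite -(card_imset _ someI); apply/subset_leq_card/subsetP.
  by move=> _ /imsetP[c cI ->]; move: cI; rewrite !inE negbK.
have nk : #|G| * (2 * k - 2) = 2 * (#|G| * k) - 2 * #|G|.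
  by rewrite mulnBr mulnCA (mulnC _ 2).
have : k * #|G| <= k * (#|I| + #|P|) by rewrite leq_mul2l cardI orbT.
have : #|G| <= #|G| * k by rewrite leq_pmulr.
rewrite mulnDr cardP; lia.
Qed.

(** * Ring graphs: layers arranged around a cycle *)

(** The modulus is at least 3, so [1 + 1] is nonzero and [i - 1], [i], [i + 1] are distinct. The
    product makes all orientations available in one rewrite. *)
Lemma ord_succE n (i : 'I_n.+3) :
  (((i + 1)%R == i) = false) * ((i == (i + 1)%R) = false) *
  (((i - 1)%R == i) = false) * ((i == (i - 1)%R) = false) *
  (((i + 1)%R == (i - 1)%R) = false) * (((i - 1)%R == (i + 1)%R) = false).
Proof.
have D1 : ((i + 1)%R == i) = false by rewrite -subr_eq0 addrAC subrr add0r.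
have D2 : ((i + 1)%R == (i - 1)%R) = false.
  by rewrite -subr_eq0 opprD opprK addrACA subrr add0r.
have D3 : ((i - 1)%R == i) = false by rewrite subr_eq eq_sym D1.
by rewrite ![i == _]eq_sym [_ == (i + 1)%R]eq_sym D1 D2 D3.
Qed.

Lemma ord_cyclic_ind n (P : pred 'I_n.+2) :
  (forall i, P i -> P (i + 1)%R) -> forall i j, P i -> P j.
Proof.
move=> step i j Pi; rewrite -[j](subrK i) addrC -[(j - i)%R]natr_Zp.
elim: (val _) => [|m IH]; first by rewrite addr0.
by rewrite mulrSr addrA; apply: step.
Qed.

(** [g] need not be symmetric: it is oriented from a layer to the next one, hence the swapped
    arguments in the last disjunct. *)
Definition ring_adj n (T : finType) (h g : rel T) : rel ('I_n.+3 * T) :=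
  fun x y => [|| (x.1 == y.1) && h x.2 y.2,
                 (y.1 == x.1 + 1)%R && g x.2 y.2
               | (x.1 == y.1 + 1)%R && g y.2 x.2].

Lemma ring_adj_sym n (T : finType) (h g : rel T) :
  symmetric h -> symmetric (@ring_adj n T h g).
Proof.
by move=> hs x y; rewrite /ring_adj eq_sym hs; congr (_ || _); rewrite orbC.
Qed.

Lemma ring_adj_irrefl n (T : finType) (h g : rel T) :
  irreflexive h -> irreflexive (@ring_adj n T h g).
Proof.
move=> hi x; rewrite /ring_adj hi andbF /=.
by rewrite ord_succE.
Qed.

Definition ring_graph n (T : finType) (h g : rel T)
    (hs : symmetric h) (hi : irreflexive h) : sgraph :=
  SGraph (ring_adj_sym (n := n) g hs) (ring_adj_irrefl (n := n) g hi).

(** The three layers involved are distinct, so the neighbours split into disjoint groups. The filter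
    [Q] lets one count serve both degrees and cuts. *)
Lemma card_ring_nbhd n (T : finType) (h g : rel T) (Q : pred ('I_n.+3 * T))
    (i : 'I_n.+3) (s : T) :
  #|[set y | ring_adj h g (i, s) y & Q y]| =
  \sum_t (h s t && Q (i, t)) + \sum_t (g s t && Q ((i + 1)%R, t))
  + \sum_t (g t s && Q ((i - 1)%R, t)).
Proof.
(* A sum over one layer is spread over all vertices by an indicator, so that the three sums can be
   merged pointwise. *)
have pt (j : 'I_n.+3) (F : 'I_n.+3 -> T -> nat) :
    \sum_t F j t = \sum_i' \sum_t (i' == j) * F i' t.
  rewrite (bigD1 j) //= [X in _ + X]big1; last first.
    by move=> i' /negPf ->; rewrite big1.
  by rewrite addn0; apply: eq_bigr => t _; rewrite eqxx mul1n.
rewrite (pt i (fun j t => h s t && Q (j, t) : nat)).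
rewrite (pt (i + 1)%R (fun j t => g s t && Q (j, t) : nat)).
rewrite (pt (i - 1)%R (fun j t => g t s && Q (j, t) : nat)).
rewrite !pair_big -!big_split /= -sum1dep_card big_mkcond /=.
apply: eq_bigr => -[j t] _ /=; rewrite /ring_adj /= (eq_sym i j).
rewrite (_ : (i == j + 1)%R = (j == i - 1)%R); last first.
  by rewrite [RHS]eq_sym subr_eq.
have [->|ji] := eqVneq j i; first by rewrite !ord_succE /= !mul0n orbF mul1n !addn0; case: ifP.
have [->|ji1] := eqVneq j (i + 1)%R.
  by rewrite !ord_succE /= !mul0n orbF mul1n !addn0 add0n; case: ifP.
have [->|ji2] := eqVneq j (i - 1)%R; last by [].
by rewrite !mul0n mul1n !add0n /=; case: ifP.
Qed.

Lemma ring_cut n (T : finType) (h g : rel T)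
    (hs : symmetric h) (hi : irreflexive h) (X : {set ring_graph n g hs hi}) :
  #|edge_cut X| =
  \sum_i \sum_s \sum_t (h s t && ((i, s) \in X) && ((i, t) \notin X)) +
  \sum_i \sum_s \sum_t (g s t && (((i, s) \in X) != (((i + 1)%R, t) \in X))).
Proof.
rewrite card_edge_cut big_mkcond /=.
pose F (x : 'I_n.+3 * T) := if x \in X then
  #|[set y | ring_adj h g x y & y \notin X]| else 0.
rewrite (eq_bigr F) //.
have -> : \sum_x F x = \sum_i \sum_s F (i, s).
  by rewrite pair_bigA; apply: eq_bigr => -[].
rewrite {}/F.
pose F1 i s := \sum_t (h s t && ((i, s) \in X) && ((i, t) \notin X) : nat).
pose F2 i s := \sum_t (g s t && ((i, s) \in X) && (((i + 1)%R, t) \notin X) : nat).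
pose F3 i s := \sum_t (g t s && ((i, s) \in X) && (((i - 1)%R, t) \notin X) : nat).
transitivity (\sum_i \sum_s (F1 i s + F2 i s + F3 i s)).
  apply: eq_bigr => i _; apply: eq_bigr => s _; rewrite card_ring_nbhd /F1 /F2 /F3.
  case: ifP => iX; last by rewrite !big1 // => t _; rewrite andbF.
  by congr (_ + _ + _); apply: eq_bigr => t _; rewrite andbT.
under eq_bigr do rewrite !big_split /=.
rewrite !big_split /= -addnA; congr (_ + _).
(* After rotating the index, the edges leaving [X] backwards start in layer [i + 1]; with those
   leaving forwards from layer [i] they make up the edges whose ends disagree. *)
have -> : \sum_i \sum_s F3 i s = \sum_i \sum_s F3 (i + 1)%R s.
  exact: (reindex_inj (addIr (1%R : 'I_n.+3))).
rewrite -big_split /=; apply: eq_bigr => i _.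
rewrite [\sum_s F3 _ _]exchange_big -big_split /=.
apply: eq_bigr => s _; rewrite -big_split /=; apply: eq_bigr => t _.
rewrite addrK.
by case: (g s t); case: (_ \in X); case: (_ \in X).
Qed.

Lemma ring_regular n (T : finType) (h g : rel T)
    (hs : symmetric h) (hi : irreflexive h) (d : nat) :
  (forall s, \sum_t (h s t : nat) + \sum_t (g s t : nat) + \sum_t (g t s : nat) = d) ->
  regular d (ring_graph n g hs hi).
Proof.
move=> deg [i s]; rewrite -(deg s).
rewrite -(eq_card (A := [set y | ring_adj h g (i, s) y & predT y])).
  rewrite card_ring_nbhd.
  by congr (_ + _ + _); apply: eq_bigr => t _; rewrite andbT.
by move=> y; rewrite !inE andbT.
Qed.

(** * Cuts of a cycle, and tools for connectivity after deletions *)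

(** [u] and [v] describe a set on the alternate vertices of a cycle, in the order [u i], [v i],
    [u (i + 1)]. A set with no exit along the cycle is constant; using this for the set and for its
    complement yields one exit and one entry. *)
Lemma crossing n (u v : pred 'I_n.+2) :
  (exists b, forall i, u i = b /\ v i = b) \/
  2 <= \sum_i (u i != v i) + \sum_i (v i != u (i + 1)%R).
Proof.
have half (u' v' : pred 'I_n.+2) :
    (exists b, forall i, u' i = b /\ v' i = b) \/
    1 <= \sum_i (u' i && ~~ v' i) + \sum_i (v' i && ~~ u' (i + 1)%R).
  have [E|] := posnP; last by right.
  move/eqP: E; rewrite addn_eq0 !sum_nat_eq0 => /andP[/forallP up /forallP dn].
  have uv i : u' i -> v' i by move: (up i); case: (u' i); case: (v' i).
  have vu i : v' i -> u' (i + 1)%R.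
    by move: (dn i); case: (v' i); case: (u' _).
  have step := ord_cyclic_ind (P := u') (fun i ui => vu i (uv i ui)).
  left; exists (u' 0%R) => i.
  case u0: (u' 0%R).
    by rewrite uv (step 0%R i u0).
  have nu j : u' j = false by apply/negP => uj; have := step j 0%R uj; rewrite u0.
  rewrite nu; split=> //; apply/negP => /vu; by rewrite nu.
case: (half u v) => [|ge1]; first by left.
case: (half (fun i => ~~ u i) (fun i => ~~ v i)) => [[b cst]|ge1'].
  left; exists (~~ b) => i; have [<- _] := cst i; have [uE vE] := cst i.
  by split; apply/negb_inj; rewrite ?negbK // vE -uE.
right; apply: leq_trans (leq_add ge1 ge1') _.
rewrite -!big_split /=; apply: eq_leq; apply: eq_bigr => i _.
by case: (u i); case: (v i); case: (u _).
Qed.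

Lemma cycle_minus_one_connect (V : finType) (r : rel V) (S : {set V})
    (f : V -> V) (O : pred V) :
  connect_sym r ->
  (forall x, O x -> O (f x)) ->
  (forall x y, O x -> O y -> fconnect f x y) ->
  (forall x, O x -> x \notin S -> f x \notin S -> r x (f x)) ->
  (forall x y, O x -> O y -> x \in S -> y \in S -> x = y) ->
  forall x y, O x -> O y -> x \notin S -> y \notin S -> connect r x y.
Proof.
move=> symr Of cyc step one.
have iterO m x : O x -> O (iter m f x) by move=> Ox; elim: m => //= m /Of.
have run x m : O x -> (forall j, j <= m -> iter j f x \notin S) ->
    connect r x (iter m f x).
  move=> Ox; elim: m => [|m IH] nS; first exact: connect0.
  apply: connect_trans (IH _) (connect1 _) => [j jm|]; first exact: nS (leqW jm).
  by apply: step; [apply: iterO | apply: nS | apply: (nS m.+1)].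
case: (pickP (fun s => O s && (s \in S))) => [s /andP[Os sS]|noS]; last first.
  move=> x y Ox Oy _ _; rewrite -(iter_findex (cyc _ _ Ox Oy)).
  by apply: run => // j _; have := noS (iter j f x); rewrite /= iterO //= => ->.
(* The successor of the deleted vertex [s] is the start of the path that remains. *)
suff root x : O x -> x \notin S -> connect r (f s) x.
  move=> x y Ox Oy xS yS; rewrite (connect_trans _ (root y Oy yS)) //.
  by rewrite symr root.
move=> Ox xS.
have ex : exists m, iter m f s == x.
  by exists (findex f s x); rewrite (iter_findex (cyc _ _ Os Ox)).
(* With the least number of steps from [s] to [x], a second visit to [s] on the way would give a
   shorter walk. *)
case: (ex_minnP ex) => -[/eqP /= sx|m /eqP mx mmin]; first by rewrite -sx sS in xS.
rewrite -mx iterSr; apply: run; first exact: Of.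
move=> j jm; rewrite -iterSr; apply/negP => jS.
have js := one _ _ (iterO j.+1 _ Os) Os jS sS.
suff /mmin : iter (m - j) f s == x by rewrite ltnNge leq_subr.
by rewrite -mx -{1}js -iterD addnS subnK.
Qed.

(** If every class of [W] is hit, [#|S| <= #|W|] leaves room for exactly one element of [S] in each
    and none elsewhere. *)
Lemma class_missed_or_transversal (V U : finType) (cl : V -> U)
    (S : {set V}) (W : {set U}) :
  #|S| <= #|W| ->
  (exists2 c, c \in W & forall x, x \in S -> cl x != c) \/
  {in S &, injective cl} /\ (forall x, x \in S -> cl x \in W).
Proof.
move=> SW; case: (boolP (W \subset cl @: S)) => [sub|/subsetPn[c cW cS]]; last first.
  left; exists c => // x xS; apply: contraNneq cS => <-; exact: imset_f.
have le1 := subset_leq_card sub; have le2 := leq_imset_card cl S.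
right; split.
  by apply/imset_injP; rewrite eqn_leq le2 (leq_trans SW).
have /eqP -> : W == cl @: S.
  by rewrite eqEcard sub (leq_trans le2).
exact: imset_f.
Qed.

Lemma avoiding_seq (V : finType) (S : {set V}) (ps : seq (seq V)) :
  uniq (flatten ps) -> #|S| < size ps ->
  exists2 p, p \in ps & {in p, forall x, x \notin S}.
Proof.
elim: ps S => [|p ps IH] S //=; rewrite cat_uniq => /and3P[_ dis un] ltS.
case: (boolP (has (fun x => x \in S) p)) => [/hasP[x xp xS]|/hasPn nS]; last first.
  by exists p; rewrite ?mem_head.
(* [x] lies on [p], hence on no later sequence: dropping [p] pays for dropping [x] from [S]. *)
case: (IH (S :\ x) un); first by move: ltS; rewrite (cardsD1 x) xS.
move=> q qps qS; exists q; first by rewrite inE qps orbT.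
move=> y yq; have := qS y yq; rewrite !inE negb_and negbK => /orP[/eqP yx|//].
case/negP: dis; apply/hasP; exists y; last by rewrite /= yx.
by apply/flattenP; exists q.
Qed.

Lemma adj_del_connect_sym (G : sgraph) (S : {set G}) :
  connect_sym (adj_del S).
Proof.
by apply: sym_connect_sym => x y; rewrite /adj_del /= adj_sym andbCA.
Qed.

(** * The product of a complete graph and a cycle, for [k >= 4] *)

Lemma neq_sym (T : eqType) : symmetric (fun s t : T => s != t).
Proof. by move=> s t; rewrite eq_sym. Qed.

Lemma neq_irrefl (T : eqType) : irreflexive (fun s t : T => s != t).
Proof. by move=> s; rewrite eqxx. Qed.

(* The Cartesian product of a complete graph on [w] vertices and a cycle. *)
Definition complete_cycle (n w : nat) : sgraph :=
  ring_graph n (fun s t : 'I_w => s == t) (@neq_sym 'I_w) (@neq_irrefl 'I_w).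

Lemma complete_cycle_regular n w : regular w.+1 (complete_cycle n w).
Proof.
apply: ring_regular => s; rewrite (bigD1 s) //= eqxx (eq_bigr (fun=> 1)).
  rewrite sum_nat_const cardC1 card_ord muln1.
  rewrite (bigD1 s) //= eqxx big1 => [|t /negPf]; last by rewrite eq_sym => ->.
  rewrite (bigD1 s) //= eqxx big1 => [|t /negPf -> //].
  by case: w s => [[]//|w _]; rewrite /= !addn0 !addn1.
by move=> t; rewrite eq_sym => ->.
Qed.

Lemma complete_cycle_independent n w (I : {set complete_cycle n w}) :
  {in I &, forall x y, ~~ adj x y} -> #|I| <= n.+3.
Proof.
move=> ind; rewrite -[n.+3]card_ord -(card_in_imset (f := fun x => x.1)).
  exact: max_card.
move=> [i s] [j t] xI yI /= ij; have := ind _ _ xI yI.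
by rewrite /= /ring_adj /= ij eqxx /= negb_or negbK => /andP[/eqP ->].
Qed.

(** [S] has at most [w] vertices and there are [w] columns. If a column avoids [S], every survivor
    reaches it inside its own layer; otherwise each column loses at most one vertex, and any two are
    linked through a layer where both survive. *)
Lemma complete_cycle_connected n w :
  1 < w -> k_connected w.+1 (complete_cycle n w).
Proof.
move=> w1; split.
  rewrite card_prod !card_ord; nia.
move=> S ltS x0 y0 xS0 yS0.
pose G := complete_cycle n w.
have symr := @adj_del_connect_sym G S.
pose f (x : G) : G := ((x.1 + 1)%R, x.2).
have col p x y : (forall x y : G, x.2 = p -> y.2 = p -> x \in S -> y \in S -> x = y) ->
    x.2 = p -> y.2 = p -> x \notin S -> y \notin S -> connect (adj_del S) x y.
  move=> one xp yp; apply: (cycle_minus_one_connect (f := f) (O := fun x => x.2 == p)).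
  - exact: symr.
  - by [].
  - move=> [i s] [j t] /= /eqP -> /eqP ->.
    apply: (ord_cyclic_ind (P := fun j => fconnect f (i, p) (j, p))) (connect0 _ _).
    by move=> m /connect_trans; apply; apply: (fconnect1 f (m, p)).
  - move=> x' xp' xS fS; rewrite /adj_del /= xS fS /ring_adj /=.
    by rewrite !eqxx orbT.
  - by move=> ? ? /eqP ? /eqP ?; apply: one.
  - by rewrite xp.
  - by rewrite yp.
have layer i s t : (i, s) \notin S -> (i, t) \notin S -> connect (adj_del S) ((i, s) : G) (i, t).
  move=> sS tS; have [->|st] := eqVneq s t; first exact: connect0.
  by apply: connect1; rewrite /adj_del /= sS tS /ring_adj /= eqxx st.
case: (@class_missed_or_transversal _ _ (fun x : G => x.2) S setT).
- by rewrite cardsT card_ord.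
- case=> c _ noS.
  have cS i : ((i, c) : G) \notin S by apply/negP => /noS; rewrite eqxx.
  suff root x : x \notin S -> connect (adj_del S) x ((0%R, c) : G).
    by rewrite (connect_trans (root x0 xS0)) // symr root.
  case: x => i s sS; apply: connect_trans (layer i s c sS (cS i)) _.
  by apply: (col c) => // x' y' xc _ /noS; rewrite xc eqxx.
- case=> inj _.
  have one p : forall x y : G, x.2 = p -> y.2 = p -> x \in S -> y \in S -> x = y.
    by move=> x y xp yp xS yS; apply: inj => //; rewrite xp yp.
  case: x0 y0 xS0 yS0 => [i s] [j t] sS tS.
  (* Each of the columns [s] and [t] spoils at most one layer, and there are at least three
     layers. *)
  have [i' i'P] : exists i', {in [:: s; t], forall p, ((i', p) : G) \notin S}.
    case: (boolP [exists m, [&& ((m, s) : G) \notin S & ((m, t) : G) \notin S]]).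
      case/existsP => m /andP[msS mtS]; exists m => p.
      by rewrite !inE => /orP[] /eqP ->.
    move/existsPn => bad.
    pose bs p := [set m : 'I_n.+3 | ((m, p) : G) \in S].
    have bs1 p : #|bs p| <= 1.
      apply/card_le1_eqP => m m'; rewrite !inE => mS mS'.
      by have [] := one p (m, p) (m', p) erefl erefl mS mS'.
    have : #|bs s :|: bs t| <= 2.
      by apply: leq_trans (leq_card_setU _ _) _; apply: (leq_add (bs1 s) (bs1 t)).
    suff -> : bs s :|: bs t = setT by rewrite cardsT card_ord.
    by apply/setP => m; have := bad m; rewrite !inE negb_and !negbK.
  have sS' : ((i', s) : G) \notin S by apply: i'P; rewrite !inE eqxx.
  have tS' : ((i', t) : G) \notin S by apply: i'P; rewrite !inE eqxx orbT.
  have C1 := col s (i, s) (i', s) (one s) erefl erefl sS sS'.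
  have C2 := col t (i', t) (j, t) (one t) erefl erefl tS' tS.
  exact: connect_trans (connect_trans C1 (layer i' s t sS' tS')) C2.
Qed.

(** If no column is constant, each is crossed twice. Otherwise, up to complement, some column [q]
    avoids the set, so no layer is full, and the count depends on how many layers are met. *)
Lemma complete_cycle_edge_connected n w :
  2 < w -> essentially_edge_connected (2 * w) (complete_cycle n w).
Proof.
move=> w3; apply: essentially_edge_connected_intro => X X1 X'1.
pose chi (Y : {set complete_cycle n w}) (i : 'I_n.+3) (s : 'I_w) := (i, s) \in Y.
pose c Y s := \sum_i (chi Y i s != chi Y (i + 1)%R s).
pose l Y i := #|[set s | chi Y i s]|.
have cutE Y : #|edge_cut Y| = \sum_i l Y i * (w - l Y i) + \sum_s c Y s.
  have -> : #|edge_cut Y| =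
    \sum_(i : 'I_n.+3) \sum_s \sum_t ((s != t) && chi Y i s && ~~ chi Y i t) +
    \sum_(i : 'I_n.+3) \sum_s \sum_t
      ((s == t) && (chi Y i s != chi Y (i + 1)%R t)) := ring_cut Y.
  rewrite [X in _ = _ + X]exchange_big; congr (_ + _).
    apply: eq_bigr => i _; rewrite -sum_nat_const.
    rewrite [RHS]big_mkcond /=; apply: eq_bigr => s _; rewrite inE.
    case: ifP => sY; last by rewrite big1 // => t _; rewrite andbF.
    have -> : w - l Y i = #|~: [set s | chi Y i s]|.
      by rewrite cardsCs setCK card_ord.
    rewrite -sum1_card [RHS]big_mkcond; apply: eq_bigr => t _.
    rewrite !inE andbT; case: eqP => [<-|_]; first by rewrite sY.
    by case: (chi Y i t).
  apply: eq_bigr => i _; under eq_bigr => s _.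
    rewrite (bigD1 s) //= eqxx big1 ?addn0; last by move=> t /negPf; rewrite eq_sym => ->.
    over.
  by [].
have c2 Y s : (exists b, forall i, chi Y i s = b) \/ 2 <= c Y s.
  case: (crossing (fun i => chi Y i s) (fun i => chi Y i s)).
    by case=> b cst; left; exists b => i; case: (cst i).
  by rewrite big1 => [|i _]; [right | rewrite eqxx].
have main (Y : {set complete_cycle n w}) q : 1 < #|Y| -> (forall i, ~~ chi Y i q) -> 2 * w <= #|edge_cut Y|.
  move=> Y1 qY.
  have lw i : l Y i < w.
    rewrite -[w]card_ord -cardsT; apply: proper_card.
    by apply/properP; split; [apply/subsetP => s | exists q]; rewrite !inE.
  have cardY : #|Y| = \sum_i l Y i.
    rewrite -sum1_card big_mkcond /=.
    transitivity (\sum_i \sum_s (chi Y i s)).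
      by rewrite pair_bigA; apply: eq_bigr => -[].
    apply: eq_bigr => i _; rewrite /l -sum1dep_card [RHS]big_mkcond.
    by apply: eq_bigr => s _; case: (chi Y i s).
  pose A := [set i | 0 < l Y i].
  have [[i0 s0] sY0] : exists x, x \in Y by apply/card_gt0P; apply: ltnW.
  have iA i s : chi Y i s -> i \in A.
    by move=> sY; rewrite inE; apply/card_gt0P; exists s; rewrite inE.
  (* For [0 < l < w] the product [l * (w - l)] is at least [w - 1]. *)
  have layers : #|A| * (w - 1) <= \sum_i l Y i * (w - l Y i).
    rewrite -sum_nat_const big_mkcond; apply: leq_sum => i _; rewrite inE.
    by case: ifP => //; have := lw i; nia.
  (* Three met layers suffice, as [3 * (w - 1) >= 2 * w] for [w >= 3]. *)
  rewrite cutE; have [A3|A2] := leqP 3 #|A|.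
    apply: leq_trans (leq_addr _ _); apply: leq_trans layers.
    by apply: leq_trans (leq_mul A3 (leqnn _)); lia.
  have [j jA] : exists j, j \notin A.
    apply/existsP; rewrite -negb_forall; apply/negP => /forallP AT.
    have : #|A| = n.+3 by rewrite -[RHS]card_ord -cardsT; apply: eq_card => i; rewrite AT inE.
    by move=> E; rewrite E in A2.
  (* Layer [j] avoids [Y], so no column meeting [Y] is constant. *)
  have cross i : 2 * l Y i <= \sum_s c Y s.
    rewrite mulnC -sum_nat_const big_mkcond; apply: leq_sum => s _; rewrite inE.
    case: ifP => // sY; case: (c2 Y s) => // -[b cst].
    by case/negP: jA; apply: (iA j s); rewrite cst -(cst i).
  have A0 : 0 < #|A| by apply/card_gt0P; exists i0; apply: iA sY0.
  have l0 : 0 < l Y i0 by have := iA _ _ sY0; rewrite inE.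
  (* Two met layers give [2 * (w - 1)], and a column meeting [Y] adds the missing 2. *)
  have [A2'|A1] := leqP 2 #|A|.
    have := cross i0; have := leq_trans (leq_mul A2' (leqnn _)) layers; lia.
  have only i : i != i0 -> l Y i = 0.
    move=> ii0; apply/eqP; rewrite -leqn0 leqNgt; apply/negP => li.
    have : #|[set i0; i]| <= #|A|.
      by apply/subset_leq_card/subsetP => m; rewrite !inE => /orP[] /eqP ->.
    by rewrite cards2 eq_sym ii0; lia.
  have lY : #|Y| = l Y i0.
    by rewrite cardY (bigD1 i0) //= big1 ?addn0.
  (* With one met layer and [l = #|Y| >= 2], the excess of [l * (w - l) + 2 * l] over [2 * w] is
     [(l - 2) * (w - l)]. *)
  have := cross i0; rewrite (bigD1 i0) //=; have := lw i0.
  move: Y1; rewrite lY; move: (l Y i0) (\sum_(i | _) _) (\sum_s _) => a b d; nia.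
case: (boolP [forall s, 1 < c X s]) => [/forallP call|].
  rewrite cutE; apply: leq_trans (leq_addl _ _).
  rewrite mulnC -{1}[w]card_ord -sum_nat_const; exact: leq_sum.
move=> /forallPn[q]; case: (c2 X q) => [[b cst] _|-> //].
case: b cst => cst; last by apply: (main X q) => // i; rewrite cst.
by rewrite -edge_cutC; apply: (main _ q) => // i; rewrite /chi inE -/(chi X i q) cst.
Qed.

(** * The seven-vertex gadget ring for [k = 3]: independence and edge cuts *)

Inductive site := A0 | A1 | B0 | B1 | C0 | C1 | D.

Definition site_seq := [:: A0; A1; B0; B1; C0; C1; D].

Definition site_code (s : site) : 'I_7 :=
  match s with
  | A0 => inord 0 | A1 => inord 1 | B0 => inord 2 | B1 => inord 3
  | C0 => inord 4 | C1 => inord 5 | D => inord 6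
  end.

Lemma site_codeK : cancel site_code (fun i : 'I_7 => nth D site_seq i).
Proof. by case; rewrite /= inordK. Qed.

HB.instance Definition _ := Finite.copy site (can_type site_codeK).

Lemma mem_site_seq s : s \in site_seq.
Proof. by case: s; rewrite !inE eqxx ?orbT. Qed.

Lemma site_seq_uniq : uniq site_seq.
Proof.
apply: (@map_uniq _ _ (fun s => val (site_code s))).
by rewrite /= !inordK.
Qed.

Lemma sum_site (F : site -> nat) :
  \sum_s F s = F A0 + F A1 + F B0 + F B1 + F C0 + F C1 + F D.
Proof.
rewrite (perm_big site_seq) /=; first by rewrite !big_cons big_nil !addnA addn0.
apply: uniq_perm; rewrite ?index_enum_uniq ?site_seq_uniq // => s.
by rewrite mem_index_enum mem_site_seq.
Qed.

Lemma site_eqE (s t : site) :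
  (s == t) = match s, t with
  | A0, A0 | A1, A1 | B0, B0 | B1, B1 | C0, C0 | C1, C1 | D, D => true
  | _, _ => false end.
Proof. by apply/eqP/idP => [->|]; [case: t | case: s; case: t]. Qed.

Definition site_adj (s t : site) : bool :=
  match s, t with
  | A0, A1 | A1, A0 | B0, B1 | B1, B0 | C0, C1 | C1, C0 => true
  | C0, (A0 | A1) | (A0 | A1), C0 => true
  | C1, (B0 | B1) | (B0 | B1), C1 => true
  | D, (A0 | A1 | B0 | B1) | (A0 | A1 | B0 | B1), D => true
  | _, _ => false
  end.

(** [D] already has four neighbours in its layer; every other site has three and gains one through
    these links. *)
Definition site_next (s t : site) : bool :=
  match s, t with
  | A1, A0 | B1, B0 | C1, C0 => true
  | _, _ => false
  end.

Lemma site_adj_sym : symmetric site_adj.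
Proof. by case; case. Qed.

Lemma site_adj_irrefl : irreflexive site_adj.
Proof. by case. Qed.

(* A layer is the blow-up of the 5-cycle [A, C0, C1, B, D] in which [A] and [B]
   become the edges [A0 A1] and [B0 B1].  The columns pass through it along
   [A0 A1], [B0 B1] and [C0 C1]. *)
Definition gadget_ring (n : nat) : sgraph :=
  ring_graph n site_next site_adj_sym site_adj_irrefl.

Lemma card_gadget_ring n : #|gadget_ring n| = n.+3 * 7.
Proof. by rewrite card_prod card_ord -[#|site : predArgType|]sum1_card sum_site. Qed.

Lemma gadget_ring_regular n : regular 4 (gadget_ring n).
Proof. by apply: ring_regular => s; rewrite !sum_site; case: s. Qed.

Lemma gadget_ring_card_set n (X : {set gadget_ring n}) :
  #|X| = \sum_(i : 'I_n.+3) \sum_s ((i, s) \in X).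
Proof.
rewrite pair_bigA -sum1_card big_mkcond /=.
by apply: eq_bigr => -[i s] _ /=; case: (_ \in X).
Qed.

(** Blowing up vertices of a 5-cycle into cliques keeps the independence number 2, so each layer
    holds at most two vertices of [I]. *)
Lemma gadget_ring_independent n (I : {set gadget_ring n}) :
  {in I &, forall x y, ~~ adj x y} -> #|I| <= n.+3 * 2.
Proof.
move=> ind; rewrite gadget_ring_card_set.
apply: (@leq_trans (\sum_(i < n.+3) 2)); last by rewrite sum_nat_const card_ord.
apply: leq_sum => i _; rewrite sum_site.
pose b s := (i, s) \in I.
have nb s t : site_adj s t -> ~~ (b s && b t).
  move=> st; apply/negP => /andP[sI tI]; have := ind _ _ sI tI.
  by rewrite /= /ring_adj /= eqxx st.
rewrite -/(b A0) -/(b A1) -/(b B0) -/(b B1) -/(b C0) -/(b C1) -/(b D).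
move: (nb A0 A1 isT) (nb B0 B1 isT) (nb C0 C1 isT) (nb A0 C0 isT) (nb A1 C0 isT).
move: (nb B0 C1 isT) (nb B1 C1 isT) (nb A0 D isT) (nb A1 D isT) (nb B0 D isT) (nb B1 D isT).
by case: (b A0); case: (b A1); case: (b B0); case: (b B1); case: (b C0);
  case: (b C1); case: (b D).
Qed.

(** These are the eight edges of a layer that lie on no column, counted when [b] separates their
    ends. *)
Definition rungs (b : site -> bool) : nat :=
  (b C0 != b A0) + (b C0 != b A1) + (b C1 != b B0) + (b C1 != b B1) +
  (b D != b A0) + (b D != b A1) + (b D != b B0) + (b D != b B1).

Lemma gadget_ring_cut n (X : {set gadget_ring n})
    (chi := fun (i : 'I_n.+3) s => (i, s) \in X)
    (cr := fun s t => \sum_i (chi i s != chi i t) +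
                      \sum_i (chi i t != chi (i + 1)%R s)) :
  #|edge_cut X| = cr A0 A1 + cr B0 B1 + cr C0 C1 + \sum_i rungs (chi i).
Proof.
have -> : #|edge_cut X| =
    \sum_i \sum_s \sum_t (site_adj s t && chi i s && ~~ chi i t) +
    \sum_i \sum_s \sum_t (site_next s t && (chi i s != chi (i + 1)%R t)) :=
  ring_cut X.
rewrite /cr -!big_split /=; apply: eq_bigr => i _.
move: (chi i) (chi (i + 1)%R) => b b'.
rewrite !sum_site /= /rungs; move: (b' A0) (b' B0) (b' C0) => x y z.
by case: (b A0); case: (b A1); case: (b B0); case: (b B1); case: (b C0);
  case: (b C1); case: (b D); case: x; case: y; case: z.
Qed.

(** Each column is inside, outside, or crossed twice. Two constant columns of opposite kinds cost
    two rungs in each of at least three layers; otherwise, up to complement, no column is inside,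
    and rungs compensate for the columns outside. *)
Lemma gadget_ring_edge_connected n :
  essentially_edge_connected 6 (gadget_ring n).
Proof.
apply: essentially_edge_connected_intro => X X1 X'1.
pose chi (Y : {set gadget_ring n}) (i : 'I_n.+3) (s : site) := (i, s) \in Y.
pose cr Y s t := \sum_i (chi Y i s != chi Y i t) +
                 \sum_i (chi Y i t != chi Y (i + 1)%R s).
pose R Y := \sum_i rungs (chi Y i).
pose cst Y b s t := forall i, chi Y i s = b /\ chi Y i t = b.
have cutE Y : #|edge_cut Y| = cr Y A0 A1 + cr Y B0 B1 + cr Y C0 C1 + R Y.
  exact: gadget_ring_cut.
have R1 Y m i : m <= rungs (chi Y i) -> m <= R Y.
  by move=> mi; rewrite /R (bigD1 i) //=; apply: leq_trans (leq_addr _ _).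
have Rw Y m : (forall i, m * \sum_s chi Y i s <= rungs (chi Y i)) -> m * #|Y| <= R Y.
  by move=> le; rewrite gadget_ring_card_set big_distrr; apply: leq_sum => i _; exact: le.
have R6 Y : (forall i, 2 <= rungs (chi Y i)) -> 6 <= R Y.
  move=> le; apply: (@leq_trans (\sum_(i < n.+3) 2)); last by apply: leq_sum.
  by rewrite sum_nat_const card_ord -[6]/(3 * 2) leq_mul2r.
have ex Y s t : 2 <= cr Y s t -> exists i, chi Y i s || chi Y i t.
  move=> c2; apply/existsP; apply: contraLR c2 => /existsPn none.
  rewrite /cr !big1 // => i _; move: (none i) (none (i + 1)%R);
    by case: (chi Y i s); case: (chi Y i t); case: (chi Y (i + 1)%R s).
have main (Y : {set gadget_ring n}) : 1 < #|Y| ->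
    cst Y false A0 A1 \/ 2 <= cr Y A0 A1 ->
    cst Y false B0 B1 \/ 2 <= cr Y B0 B1 ->
    cst Y false C0 C1 \/ 2 <= cr Y C0 C1 -> 6 <= #|edge_cut Y|.
  move=> Y1; rewrite cutE => -[a|a] [b|b] [c|c].
  - have : 4 * #|Y| <= R Y; last by lia.
    apply: Rw => i; rewrite sum_site /rungs.
    have [-> ->] := a i; have [-> ->] := b i; have [-> ->] := c i.
    by case: (chi Y i D).
  - have : 2 * #|Y| <= R Y; last by lia.
    apply: Rw => i; rewrite sum_site /rungs.
    have [-> ->] := a i; have [-> ->] := b i.
    by case: (chi Y i C0); case: (chi Y i C1); case: (chi Y i D).
  - case: (boolP [exists i, chi Y i D]) => [/existsP[i Di]|/existsPn nD].
      have : 4 <= R Y; last by lia.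
      apply: (R1 _ _ i); rewrite /rungs Di.
      have [-> ->] := a i; have [-> ->] := c i.
      by case: (chi Y i B0); case: (chi Y i B1).
    have : 2 * #|Y| <= R Y; last by lia.
    apply: Rw => i; rewrite sum_site /rungs.
    have [-> ->] := a i; have [-> ->] := c i; rewrite (negPf (nD i)).
    by case: (chi Y i B0); case: (chi Y i B1).
  - have [i Ci] := ex _ _ _ c.
    have : 2 <= R Y; last by lia.
    apply: (R1 _ _ i); move: Ci; rewrite /rungs; have [-> ->] := a i.
    by case: (chi Y i B0); case: (chi Y i B1); case: (chi Y i C0);
      case: (chi Y i C1); case: (chi Y i D).
  - case: (boolP [exists i, chi Y i D]) => [/existsP[i Di]|/existsPn nD].
      have : 4 <= R Y; last by lia.
      apply: (R1 _ _ i); rewrite /rungs Di.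
      have [-> ->] := b i; have [-> ->] := c i.
      by case: (chi Y i A0); case: (chi Y i A1).
    have : 2 * #|Y| <= R Y; last by lia.
    apply: Rw => i; rewrite sum_site /rungs.
    have [-> ->] := b i; have [-> ->] := c i; rewrite (negPf (nD i)).
    by case: (chi Y i A0); case: (chi Y i A1).
  - have [i Ci] := ex _ _ _ c.
    have : 2 <= R Y; last by lia.
    apply: (R1 _ _ i); move: Ci; rewrite /rungs; have [-> ->] := b i.
    by case: (chi Y i A0); case: (chi Y i A1); case: (chi Y i C0);
      case: (chi Y i C1); case: (chi Y i D).
  - have [i Ai] := ex _ _ _ a; have [j Bj] := ex _ _ _ b.
    have : 1 <= \sum_i (chi Y i A0 || chi Y i A1) by rewrite (bigD1 i) //= Ai.
    have : 1 <= \sum_i (chi Y i B0 || chi Y i B1) by rewrite (bigD1 j) //= Bj.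
    (* Crossings supply 4; the other 2 come from a rung for a layer where [A] meets [Y] and one for
       a layer where [B] does, counted separately even if these layers coincide. *)
    have : \sum_i (chi Y i A0 || chi Y i A1) + \sum_i (chi Y i B0 || chi Y i B1)
           <= R Y; last by lia.
    rewrite -big_split; apply: leq_sum => m _; rewrite /rungs; have [-> ->] := c m.
    by case: (chi Y m A0); case: (chi Y m A1); case: (chi Y m B0);
      case: (chi Y m B1); case: (chi Y m D).
  - lia.
have chiC i s : chi (~: X) i s = ~~ chi X i s by rewrite /chi inE.
have crC s t : cr (~: X) s t = cr X s t.
  by congr (_ + _); apply: eq_bigr => i _; rewrite !chiC (inj_eq negb_inj).
have cstC s t : cst X true s t -> cst (~: X) false s t.
  by move=> h i; rewrite !chiC; have [-> ->] := h i.
have col s t : cst X true s t \/ cst X false s t \/ 2 <= cr X s t.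
  case: (crossing (fun i => chi X i s) (fun i => chi X i t)) => [[[] ?]|?].
  - by left.
  - by right; left.
  - by right; right.
have allin : (cst X true A0 A1 \/ 2 <= cr X A0 A1) ->
    (cst X true B0 B1 \/ 2 <= cr X B0 B1) ->
    (cst X true C0 C1 \/ 2 <= cr X C0 C1) -> 6 <= #|edge_cut X|.
  move=> a b c; rewrite -edge_cutC; apply: main => //; rewrite crC.
  - by case: a => [/cstC|]; [left | right].
  - by case: b => [/cstC|]; [left | right].
  - by case: c => [/cstC|]; [left | right].
have mixed b : (cst X b A0 A1 /\ cst X (~~ b) B0 B1) \/
    (cst X b A0 A1 /\ cst X (~~ b) C0 C1) \/
    (cst X b B0 B1 /\ cst X (~~ b) C0 C1) -> 6 <= #|edge_cut X|.
  move=> mix; rewrite cutE; apply: leq_trans (leq_addl _ _); apply: R6 => i.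
  rewrite /rungs; case: mix => [|[]] [p q]; have [-> ->] := p i; have [-> ->] := q i.
  - by case: b {p q}; case: (chi X i C0); case: (chi X i C1); case: (chi X i D).
  - by case: b {p q}; case: (chi X i B0); case: (chi X i B1); case: (chi X i C1);
      case: (chi X i D).
  - by case: b {p q}; case: (chi X i A0); case: (chi X i A1); case: (chi X i C0);
      case: (chi X i D).
have mixedT := mixed true; have mixedF := mixed false; have outX := main X X1.
case: (col A0 A1) => [a|[a|a]]; case: (col B0 B1) => [b|[b|b]];
  case: (col C0 C1) => [c|[c|c]]; tauto.
Qed.

(** * Vertex connectivity of the gadget ring *)

Definition column (s : site) : site :=
  match s with
  | A0 | A1 => A0 | B0 | B1 => B0 | C0 | C1 => C0 | D => D
  end.

(** [D] lies on no column; fixing it is a default that makes the map total. *)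
Definition column_next n (x : 'I_n.+3 * site) : 'I_n.+3 * site :=
  match x.2 with
  | A0 => (x.1, A1) | A1 => ((x.1 + 1)%R, A0)
  | B0 => (x.1, B1) | B1 => ((x.1 + 1)%R, B0)
  | C0 => (x.1, C1) | C1 => ((x.1 + 1)%R, C0)
  | D => x
  end.

(** Two steps advance by one layer, so iteration from the first site of a column reaches that site
    in every layer; at most one more step is needed at either end. *)
Lemma column_next_fconnect n (x y : 'I_n.+3 * site) :
  column x.2 = column y.2 -> column x.2 != D -> fconnect (@column_next n) x y.
Proof.
case: x => i s; case: y => j t /=.
have fc := fconnect1 (@column_next n).
have turn s' i' : column s' = s' -> s' != D ->
    fconnect (@column_next n) (i', s') (j, s').
  move=> s's' s'D; apply: (ord_cyclic_ind
    (P := fun j => fconnect (@column_next n) (i', s') (j, s'))) (connect0 _ _).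
  move=> m mP; apply: connect_trans mP _.
  have -> : ((m + 1)%R, s') = column_next (column_next (m, s')).
    by move: s's' s'D; rewrite site_eqE; case: s'.
  exact: connect_trans (fc _) (fc _).
have from_base u : fconnect (@column_next n) (j, column u) (j, u).
  by case: u; [exact: connect0 | exact: (fc (j, A0)) | exact: connect0
    | exact: (fc (j, B0)) | exact: connect0 | exact: (fc (j, C0)) | exact: connect0].
have to_base u : column u != D -> fconnect (@column_next n) (i, u) (j, column u).
  case: u => uD; try exact: turn.
  - exact: connect_trans (fc (i, A1)) (turn A0 _ erefl uD).
  - exact: connect_trans (fc (i, B1)) (turn B0 _ erefl uD).
  - exact: connect_trans (fc (i, C1)) (turn C0 _ erefl uD).
by move=> st sD; apply: connect_trans (to_base s sD) _; rewrite st.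
Qed.

Lemma path_connect_del (G : sgraph) (S : {set G}) (x y : G) (p : seq G) :
  x \notin S -> y \notin S -> {in p, forall v, v \notin S} ->
  path (@adj G) x (rcons p y) -> connect (adj_del S) x y.
Proof.
move=> xS yS; elim: p x xS => [|v p IH] x xS pS /= /andP[xv walk].
  by apply: connect1; rewrite /adj_del /= xS yS xv.
have vS : v \notin S by apply: pS; rewrite mem_head.
apply: connect_trans (IH v vS _ walk); last by move=> u up; apply: pS; rewrite inE up orbT.
by apply: connect1; rewrite /adj_del /= xS vS xv.
Qed.

(** Only the interiors of the walks must be disjoint: their ends lie in [O], which avoids [S], and
    may coincide. *)
Lemma fan_connect (G : sgraph) (S : {set G}) (O : pred G) (z x : G)
    (fan : seq (seq G * G)) :
  {in O, forall y, y \notin S /\ connect (adj_del S) y z} ->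
  x \notin S -> #|S| < size fan -> uniq (flatten (unzip1 fan)) ->
  all (fun r => path (@adj G) x (rcons r.1 r.2) && (r.2 \in O)) fan ->
  connect (adj_del S) x z.
Proof.
move=> target xS ltS un /allP walks.
have := @avoiding_seq _ S _ un; rewrite size_map => /(_ ltS).
case=> p /mapP[[q y] qfan /= ->] qS.
have /andP[/= walk yO] := walks _ qfan; have [yS yz] := target y yO.
exact: connect_trans (path_connect_del xS yS qS walk) yz.
Qed.

(** [S] has at most three vertices, the number of columns. Either a column is intact and every
    survivor off it is adjacent to it or has a fan of four walks to it, or each column loses at most
    one vertex, no copy of [D] is deleted, and everything is gathered at one such copy. *)
Lemma gadget_ring_connected n : k_connected 4 (gadget_ring n).
Proof.
split; first by rewrite card_gadget_ring; lia.
move=> S ltS x0 y0 xS0 yS0.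
pose G := gadget_ring n.
have symr := @adj_del_connect_sym G S.
suff [z root] : exists z, forall x : G, x \notin S -> connect (adj_del S) x z.
  by rewrite (connect_trans (root x0 xS0)) // symr root.
have col c x y : c != D ->
    (forall x y : G, column x.2 = c -> column y.2 = c -> x \in S -> y \in S -> x = y) ->
    column x.2 = c -> column y.2 = c -> x \notin S -> y \notin S ->
    connect (adj_del S) x y.
  move=> cD one xc yc.
  apply: (cycle_minus_one_connect (f := @column_next n : G -> G)
            (O := fun x : G => column x.2 == c)); rewrite ?xc ?yc //.
  - by case=> i []; rewrite /= => /eqP <-.
  - move=> u v /eqP uc /eqP vc.
    by apply: column_next_fconnect; rewrite uc ?vc.
  - case=> i s /= sc uS vS; rewrite /adj_del /= uS vS /=; move: cD.
    by rewrite -(eqP sc) /ring_adj; case: s {sc uS vS}; rewrite /= ?eqxx ?orbT.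
  - by move=> u v /eqP ? /eqP ?; apply: one.
case: (@class_missed_or_transversal _ _ (fun x : G => column x.2) S [set A0; B0; C0]).
- by rewrite -[X in _ <= X]sum1_card [X in _ <= X]big_mkcond sum_site !inE !site_eqE.
- case=> c cW noS; exists (0%R, c).
  have cD : c != D by move: cW; rewrite !inE => /orP[/orP[]|] /eqP ->; rewrite site_eqE.
  have cc : column c = c by move: cW; rewrite !inE => /orP[/orP[]|] /eqP ->.
  pose O := [pred x : G | column x.2 == c].
  have cS (x : G) : column x.2 = c -> x \notin S.
    by move=> xc; apply/negP => /noS; rewrite xc eqxx.
  have target : {in O, forall y, y \notin S /\ connect (adj_del S) y (0%R, c)}.
    move=> y; rewrite inE => /eqP yc; split; first exact: cS.
    apply: (col c) => //; try exact: cS.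
    by move=> u v uc _ uS; have := cS _ uc; rewrite uS.
  move=> [i s] sS.
  have direct (y : G) : ring_adj site_adj site_next (i, s) y -> column y.2 = c ->
      connect (adj_del S) ((i, s) : G) (0%R, c).
    move=> sy yc; apply: connect_trans (proj2 (target y _)); last by rewrite inE yc.
    by apply: connect1; rewrite /adj_del /= sS cS.
  have self : column s = c -> connect (adj_del S) ((i, s) : G) (0%R, c).
    by move=> sc; apply: (proj2 (target _ _)); rewrite inE /= sc.
  pose ip := (i + 1)%R; pose im := (i - 1)%R.
  have adjE : (((ip == i) = false) * ((i == ip) = false) *
      ((im == i) = false) * ((i == im) = false) * ((ip == im) = false) *
      ((im == ip) = false) * ((i == im + 1)%R = true) * ((i + 1 == ip)%R = true) *
      ((i == i) = true) * ((ip == ip) = true) * ((im == im) = true))%type.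
    by rewrite /ip /im !ord_succE subrK !eqxx.
  have fan4 (r : seq (seq G * G)) : size r = 4 -> uniq (flatten (unzip1 r)) ->
      all (fun r => path (@adj G) ((i, s) : G) (rcons r.1 r.2) && (column r.2.2 == c)) r ->
      connect (adj_del S) ((i, s) : G) (0%R, c).
    by move=> r4 un walks; apply: (fan_connect (fan := r) target sS); rewrite ?r4.
  (* Only the sites not adjacent to the intact column need a fan. Its walks leave by the four
     neighbours of the vertex and stay in the layers [i - 1], [i], [i + 1]. *)
  move: cW; rewrite !inE -orbA => /or3P[] /eqP cE; rewrite {}cE in cD cc O cS target direct self fan4 *;
  case: s sS fan4 direct self => sS fan4 direct self; try exact: self.
  + by apply: (fan4 [:: ([:: (i, C1); (i, C0)], (i, A0));
      ([:: (i, D)], (i, A0));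
      ([:: (im, B1); (im, D)], (im, A0));
      ([:: (i, B1); (ip, B0); (ip, D)], (ip, A0))]);
    rewrite /= ?inE ?xpair_eqE /ring_adj /= ?adjE ?site_eqE ?andbF.
  + by apply: (fan4 [:: ([:: (i, C1); (i, C0)], (i, A0));
      ([:: (i, D)], (i, A0));
      ([:: (ip, B0); (ip, D)], (ip, A0));
      ([:: (i, B0); (im, B1); (im, D)], (im, A0))]);
    rewrite /= ?inE ?xpair_eqE /ring_adj /= ?adjE ?site_eqE ?andbF.
  + by apply: (direct (i, A0)); rewrite /ring_adj //= eqxx.
  + by apply: (fan4 [:: ([:: (i, C0)], (i, A0));
      ([:: (ip, C0)], (ip, A0));
      ([:: (i, B0); (im, B1); (im, D)], (im, A0));
      ([:: (i, B1); (i, D)], (i, A0))]);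
    rewrite /= ?inE ?xpair_eqE /ring_adj /= ?adjE ?site_eqE ?andbF.
  + by apply: (direct (i, A0)); rewrite /ring_adj //= eqxx.
  + by apply: (fan4 [:: ([:: (i, C0); (i, C1)], (i, B0));
      ([:: (i, D)], (i, B0));
      ([:: (im, A1); (im, D)], (im, B0));
      ([:: (i, A1); (ip, A0); (ip, D)], (ip, B0))]);
    rewrite /= ?inE ?xpair_eqE /ring_adj /= ?adjE ?site_eqE ?andbF.
  + by apply: (fan4 [:: ([:: (i, C0); (i, C1)], (i, B0));
      ([:: (i, D)], (i, B0));
      ([:: (ip, A0); (ip, D)], (ip, B0));
      ([:: (i, A0); (im, A1); (im, D)], (im, B0))]);
    rewrite /= ?inE ?xpair_eqE /ring_adj /= ?adjE ?site_eqE ?andbF.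
  + by apply: (fan4 [:: ([:: (i, C1)], (i, B0));
      ([:: (im, C1)], (im, B0));
      ([:: (i, A0); (im, A1); (im, D)], (im, B0));
      ([:: (i, A1); (i, D)], (i, B0))]);
    rewrite /= ?inE ?xpair_eqE /ring_adj /= ?adjE ?site_eqE ?andbF.
  + by apply: (direct (i, B0)); rewrite /ring_adj //= eqxx.
  + by apply: (direct (i, B0)); rewrite /ring_adj //= eqxx.
  + by apply: (direct (i, C0)); rewrite /ring_adj //= eqxx.
  + by apply: (direct (i, C0)); rewrite /ring_adj //= eqxx.
  + by apply: (direct (i, C1)); rewrite /ring_adj //= eqxx.
  + by apply: (direct (i, C1)); rewrite /ring_adj //= eqxx.
  + by apply: (fan4 [:: ([:: (i, A0)], (i, C0));
      ([:: (i, A1)], (i, C0));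
      ([:: (i, B0)], (i, C1));
      ([:: (i, B1)], (i, C1))]);
    rewrite /= ?inE ?xpair_eqE /ring_adj /= ?adjE ?site_eqE ?andbF.
- case=> inj inW; exists (0%R, D).
  have one c : forall x y : G, column x.2 = c -> column y.2 = c ->
      x \in S -> y \in S -> x = y.
    by move=> x y xc yc xS yS; apply: inj => //; rewrite xc yc.
  have DS i : ((i, D) : G) \notin S.
    by apply/negP => /inW; rewrite !inE !site_eqE.
  have alive (x y : G) : column x.2 = column y.2 -> x != y -> x \notin S \/ y \notin S.
    move=> xy nxy; have [xS|] := boolP (x \in S); last by left.
    have [yS|] := boolP (y \in S); last by right.
    by case/eqP: nxy; apply: one xy erefl xS yS.
  have adjS (x y : G) : x \notin S -> y \notin S -> ring_adj site_adj site_next x y ->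
      connect (adj_del S) x y.
    by move=> xS yS xy; apply: connect1; rewrite /adj_del /= xS yS.
  have aliveA i : exists t, [/\ ((i, t) : G) \notin S, column t = A0,
      site_adj t D & site_adj t C0].
    case: (alive (i, A0) (i, A1)) => // [|tS|tS]; first by rewrite xpair_eqE site_eqE andbF.
      by exists A0.
    by exists A1.
  have aliveB i : exists t, [/\ ((i, t) : G) \notin S, column t = B0 & site_adj t D].
    case: (alive (i, B0) (i, B1)) => // [|tS|tS]; first by rewrite xpair_eqE site_eqE andbF.
      by exists B0.
    by exists B1.
  have toD i s : ((i, s) : G) \notin S -> column s \in [:: A0; B0] ->
      connect (adj_del S) ((i, s) : G) (0%R, D).
    move=> sS; rewrite !inE => sc.
    have [t [tS tc tD]] : exists t, [/\ ((0%R, t) : G) \notin S, column t = column s & site_adj t D].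
      case/orP: sc => /eqP ->; last exact: aliveB.
      by have [t [? ? ? _]] := aliveA 0%R; exists t.
    have sD : column s != D by case/orP: sc => /eqP ->; rewrite site_eqE.
    apply: connect_trans (col (column s) (i, s) (0%R, t) sD (one _) erefl tc sS tS) _.
    by apply: (adjS _ _ tS (DS _)); rewrite /ring_adj /= tD.
  have viaA (x : G) i t : x \notin S -> ((i, t) : G) \notin S -> column t = A0 ->
      ring_adj site_adj site_next x (i, t) -> connect (adj_del S) x (0%R, D).
    move=> xS tS tc xt; apply: connect_trans (adjS _ _ xS tS xt) _.
    by apply: toD tS _; rewrite tc mem_head.
  have fromD i : connect (adj_del S) ((i, D) : G) (0%R, D).
    have [t [tS tc tD _]] := aliveA i; apply: (viaA _ i t (DS i) tS tc).
    by rewrite /ring_adj [site_adj _ _]site_adj_sym /= eqxx tD.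
  have fromC i s : ((i, s) : G) \notin S -> column s = C0 ->
      connect (adj_del S) ((i, s) : G) (0%R, D).
    move=> sS sc.
    (* Only one vertex of this column can be deleted, so two copies of [C0] are enough to find a
       survivor. *)
    have [j jS] : exists j, ((j, C0) : G) \notin S.
      case: (alive (0%R, C0) ((0 + 1)%R, C0)) => // [?|?].
      - by exists 0%R.
      - by exists (0 + 1)%R.
    apply: connect_trans (col C0 (i, s) (j, C0) _ (one _) sc erefl sS jS) _.
      by rewrite site_eqE.
    have [t [tS tc _ tC]] := aliveA j; apply: (viaA _ j t jS tS tc).
    by rewrite /ring_adj [site_adj _ _]site_adj_sym /= eqxx tC.
  by move=> [i []] sS; first [exact: fromC | exact: fromD |
    by apply: toD sS _; rewrite !inE !site_eqE].
Qed.

(** * Infinite families and the choice of parameters *)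

(** [a] bounds the independent vertices per layer; [k * a < #|T|] then contradicts the independent
    set that a decomposition would produce. *)
Lemma ring_family (k : nat) (T : finType) (G : nat -> sgraph) (a : nat) :
  3 <= k -> 0 < #|T| -> k * a < #|T| ->
  (forall n, #|G n| = n.+3 * #|T|) ->
  (forall n, k_connected (2 * k - 2) (G n)) ->
  (forall n, essentially_edge_connected (4 * k - 6) (G n)) ->
  (forall n, regular (2 * k - 2) (G n)) ->
  (forall n (I : {set G n}),
     {in I &, forall x y, ~~ adj x y} -> #|I| <= n.+3 * a) ->
  exists H : nat -> sgraph,
    (forall i j : nat, isomorphic (H i) (H j) -> i = j) /\
    forall i : nat,
      [/\ k_connected (2 * k - 2) (H i),
          essentially_edge_connected (4 * k - 6) (H i),
          regular (2 * k - 2) (H i),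
          k %| #|edges (H i)| &
          ~ star_decomposable k (H i)].
Proof.
move=> k3 T0 aT cardG con econ reg ind.
(* The ring gets [k * i.+1] layers, at least 3 since [k >= 3]: this makes [k] divide the number of
   edges and gives different orders for different [i]. *)
pose m i := k * i.+1 - 3.
have mE i : (m i).+3 = k * i.+1 by rewrite /m; nia.
exists (fun i => G (m i)); split.
  move=> i j [f [/bij_eq_card + _]]; rewrite !cardG !mE => /eqP.
  by rewrite eqn_pmul2r // eqn_pmul2l ?(leq_trans _ k3) // => /eqP [].
move=> i; split=> //.
  have E : #|edges (G (m i))| = #|G (m i)| * (k - 1).
    have := handshake (G (m i)).
    rewrite (eq_bigr _ (fun x _ => reg _ x)) sum_nat_const.
    have -> : 2 * k - 2 = (k - 1) * 2 by lia.
    by rewrite mulnA => /eqP; rewrite eqn_pmul2r // => /eqP.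
  by rewrite E cardG mE -!mulnA dvdn_mulr.
move=> dec; case: (star_decomposable_independent (reg _) _ dec); first by lia.
move=> I /ind le; apply/negP; rewrite cardG -ltnNge.
apply: (@leq_ltn_trans (k * ((m i).+3 * a))); first by rewrite leq_mul2l le orbT.
by rewrite mulnCA ltn_pmul2l.
Qed.

Theorem theorem3p1 (k : nat) (hk : 3 <= k) :
  exists G : nat -> sgraph,
    (forall i j : nat, isomorphic (G i) (G j) -> i = j) /\
    forall i : nat,
      [/\ k_connected (2 * k - 2) (G i),
          essentially_edge_connected (4 * k - 6) (G i),
          regular (2 * k - 2) (G i),
          k %| #|edges (G i)| &
          ~ star_decomposable k (G i)].
Proof.
have [k3|k4] := leqP k 3.
  have -> : k = 3 by apply/eqP; rewrite eqn_leq k3 hk.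
  apply: (@ring_family 3 site gadget_ring 2).
  - by [].
  - by rewrite -sum1_card sum_site.
  - by rewrite -sum1_card sum_site.
  - by move=> n; rewrite card_gadget_ring -[#|site : predArgType|]sum1_card sum_site.
  - exact: gadget_ring_connected.
  - exact: gadget_ring_edge_connected.
  - exact: gadget_ring_regular.
  - exact: gadget_ring_independent.
(* Layers are cliques, so [a = 1], and [k < 2 * k - 3] holds because [k > 3]. *)
pose w := 2 * k - 3.
have wE : 2 * k - 2 = w.+1 by rewrite /w; lia.
have w2E : 4 * k - 6 = 2 * w by rewrite /w; lia.
apply: (@ring_family k 'I_w (fun n => complete_cycle n w) 1).
- exact: hk.
- by rewrite card_ord /w; lia.
- by rewrite card_ord /w; lia.
- by move=> n; rewrite card_prod card_ord.
- by move=> n; rewrite wE; apply: complete_cycle_connected; rewrite /w; lia.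
- by move=> n; rewrite w2E; apply: complete_cycle_edge_connected; rewrite /w; lia.
- by move=> n; rewrite wE; apply: complete_cycle_regular.
- by move=> n I; rewrite muln1; apply: complete_cycle_independent.
Qed.
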